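(* Let $d\ge 1$ and let $\Lambda_s:B(\mathbb{C}^d)\to B(\mathbb{C}^d)$ be a completely positive trace preserving linear map that is bijective on $B(\mathbb{C}^d)$. Let $I(\mathcal{I}_{d+1}\otimes\Lambda_s)$ denote the image of the set of states on $\mathbb{C}^{d+1}\otimes\mathbb{C}^d$ under $\mathcal{I}_{d+1}\otimes\Lambda_s$. Let $|a_1\rangle,\dots,|a_d\rangle$ be an orthonormal basis of $\mathbb{C}^d$, let $\mathcal{H}_A\subset\mathbb{C}^{d+1}$ be a $d$-dimensional subspace with orthonormal basis $|b_1\rangle,\dots,|b_d\rangle$, let $|d+1\rangle\in\mathbb{C}^{d+1}$ be a unit vector orthogonal to $\mathcal{H}_A$, and set $\phi^+=\frac1d\sum_{i,j=1}^d|b_i\rangle\langle b_j|\otimes|a_i\rangle\langle a_j|$. Let $\rho_S$ be any state on $\mathbb{C}^d$ and let $\sigma$ be any state in the interior of $I(\mathcal{I}_{d+1}\otimes\Lambda_s)$. Then for all sufficiently small $p>0$ the states $$\rho'=(1-p)\sigma+p\,\phi^+,\qquad \rho''=(1-p)\sigma+p\,|d+1\rangle\langle d+1|\otimes\rho_S$$ both lie in $I(\mathcal{I}_{d+1}\otimes\Lambda_s)$, so that $\rho_1=(\mathcal{I}_{d+1}\otimes\Lambda_s^{-1})(\rho')$ and $\rho_2=(\mathcal{I}_{d+1}\otimes\Lambda_s^{-1})(\rho'')$ are states on $\mathbb{C}^{d+1}\otimes\mathbb{C}^d$; and for every completely positive trace preserving linear map $\Lambda_t:B(\mathbb{C}^d)\to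 B(\mathbb{C}^d)$ such that $V_{t,s}=\Lambda_t\Lambda_s^{-1}$ is not completely positive, $$\|(\mathcal{I}_{d+1}\otimes\Lambda_t)(\rho_1-\rho_2)\|_1>\|(\mathcal{I}_{d+1}\otimes\Lambda_s)(\rho_1-\rho_2)\|_1 .$$
   Context: $B(\mathbb{C}^n)$ is the space of linear operators on $\mathbb{C}^n$; a state is a positive semidefinite operator of trace one; $\mathcal{I}_n$ is the identity map on $B(\mathbb{C}^n)$; $\|\cdot\|_1$ is the trace norm. A state $\sigma$ is in the interior of $I(\mathcal{I}_{d+1}\otimes\Lambda_s)$ if there is a set $X\subset I(\mathcal{I}_{d+1}\otimes\Lambda_s)$ containing $\sigma$ that is open in the set of all states on $\mathbb{C}^{d+1}\otimes\mathbb{C}^d$ (with its usual topology). *)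

(* Defs.v *)
From HB Require Import structures.
From mathcomp Require Import all_boot all_order all_algebra.
From mathcomp Require Import sesquilinear spectral.
From mathcomp Require Import mxtens complex.
From mathcomp Require Import all_classical all_reals all_analysis.

Set Implicit Arguments.
Unset Strict Implicit.
Unset Printing Implicit Defensive.

Import Order.TTheory GRing.Theory Num.Theory.
Import numFieldNormedType.Exports.

Local Open Scope ring_scope.
Local Open Scope classical_set_scope.
Local Open Scope sesquilinear_scope.

(* Operators on C^n are matrices 'M[C]_n acting on column vectors 'cV[C]_n, and
   the adjoint of A is A^t*.  Operators on C^m (x) C^n are matrices
   'M[C]_(m * n), where mxtens_index (i, k) is the index of the product basis
   vector e_i (x) e_k, so that the Kronecker product A *t B is A (x) B. *)

(* R[i] is wrapped in its structure because it gets its usual topology from the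
   numClosedFieldType instance. *)
Definition Cplx (R : realType) : numClosedFieldType := R[i].

(* In a numClosedFieldType, 0 <= z says that z is real and nonnegative; hence
   psdmx implies self-adjointness. *)
Definition psdmx (C : numClosedFieldType) n (A : 'M[C]_n) : Prop :=
  forall v : 'cV[C]_n, 0 <= (v^t* *m A *m v) ord0 ord0.

Definition states (C : numClosedFieldType) n : set 'M[C]_n :=
  [set rho | psdmx rho /\ \tr rho = 1].
Arguments states {C n}.

(* I_m (x) L: apply L to each of the m * m blocks of size n * n. *)
Definition idtens (C : numClosedFieldType) m n (L : 'End('M[C]_n))
    (X : 'M[C]_(m * n)) : 'M[C]_(m * n) :=
  \sum_(i < m) \sum_(j < m) delta_mx i j *t
    L (\matrix_(k, l) X (mxtens_index (i, k)) (mxtens_index (j, l))).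

Lemma idtensE (C : numClosedFieldType) m n (L : 'End('M[C]_n))
    (A : 'M[C]_m) (B : 'M[C]_n) : idtens L (A *t B) = A *t L B.
Proof.
have blockE i j : \matrix_(k, l)
    (A *t B) (mxtens_index (i, k)) (mxtens_index (j, l)) = A i j *: B.
  by apply/matrixP => k l; rewrite !mxE !mxtens_indexK.
apply/matrixP => p q.
case: (mxtens_indexP p) => i k; case: (mxtens_indexP q) => j l.
rewrite tensmxE /idtens summxE (bigD1 i) //= summxE (bigD1 j) //=.
rewrite blockE linearZ /= tensmxE !mxE !eqxx mul1r.
rewrite [X in _ + X + _]big1 ?addr0 => [|j' /negPf j'j]; last first.
  by rewrite tensmxE !mxE eqxx [j == _]eq_sym j'j mul0r.
rewrite big1 ?addr0 // => i' /negPf i'i.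
rewrite summxE big1 // => j' _.
by rewrite tensmxE !mxE [i == _]eq_sym i'i mul0r.
Qed.

Definition completely_positive (C : numClosedFieldType) n
    (L : 'End('M[C]_n)) : Prop :=
  forall m (X : 'M[C]_(m * n)), psdmx X -> psdmx (idtens L X).

Definition trace_preserving (C : numClosedFieldType) n
    (L : 'End('M[C]_n)) : Prop :=
  forall X : 'M[C]_n, \tr (L X) = \tr X.

Definition cptp (C : numClosedFieldType) n (L : 'End('M[C]_n)) : Prop :=
  completely_positive L /\ trace_preserving L.

(* \tr |A| with |A| the square root of A^t* *m A, that is, the sum of the
   singular values of A; it is a nonnegative real element of C. *)
Definition trace_norm (C : numClosedFieldType) n (A : 'M[C]_n) : C :=
  \sum_(i < n) sqrtC (spectral_diag (A^t* *m A) ord0 i).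

Definition state_image (C : numClosedFieldType) m n (L : 'End('M[C]_n)) :
    set 'M[C]_(m * n) :=
  idtens L @` states.
Arguments state_image {C} m {n} L.

Definition interior_in_states (C : numClosedFieldType) n (S : set 'M[C]_n)
    (sigma : 'M[C]_n) : Prop :=
  exists X : set 'M[C]_n, [/\ X sigma, X `<=` S &
    exists2 U : set 'M[C]_n, open U & X = U `&` states].

Definition orthonormal_basis (C : numClosedFieldType) n k
    (V : {vspace 'cV[C]_n}) (e : k.-tuple 'cV[C]_n) : Prop :=
  basis_of V e /\
  forall i j : 'I_k, (tnth e i)^t* *m tnth e j = (i == j)%:R%:M.

Definition ketbra (C : numClosedFieldType) n (u v : 'cV[C]_n) : 'M[C]_n :=
  u *m v^t*.

Definition phi_plus (C : numClosedFieldType) m n k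
    (b : k.-tuple 'cV[C]_m) (a : k.-tuple 'cV[C]_n) : 'M[C]_(m * n) :=
  k%:R^-1 *: \sum_(i < k) \sum_(j < k)
    ketbra (tnth b i) (tnth b j) *t ketbra (tnth a i) (tnth a j).

(* Main.v *)
Require Import Defs.
From HB Require Import structures.
From mathcomp Require Import all_boot all_order all_algebra.
From mathcomp Require Import sesquilinear spectral.
From mathcomp Require Import mxtens complex ring.
From mathcomp Require Import all_classical all_reals all_analysis.

Set Implicit Arguments.
Unset Strict Implicit.
Unset Printing Implicit Defensive.

Import Order.TTheory GRing.Theory Num.Theory.
Import numFieldNormedType.Exports.

Local Open Scope ring_scope.
Local Open Scope classical_set_scope.
Local Open Scope sesquilinear_scope.
Local Open Scope complex_scope.

(* Put V = Lt Ls^-1 and W = phi^+ - |e><e| (x) rhoS, so that the two operators to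
   be compared are p W and p (id (x) V) W.  The unitary (1 - 2 |e><e|) (x) 1
   commutes with id (x) V and turns W into the positive operator
   Y = phi^+ + |e><e| (x) rhoS, hence the two trace norms are p ||Y||_1 = p tr Y
   and p ||(id (x) V) Y||_1.  The operator (id (x) V) Y is Hermitian of the same
   trace, and it is not positive: its compression to the complement of e is the
   Choi operator of V.  A Hermitian operator that is not positive has a negative
   eigenvalue, so its trace norm exceeds its trace. *)

(** * Adjoints, spectral decomposition and the trace norm *)

Section Adjoint.
Variable C : numClosedFieldType.

Lemma adjmxM m n p (A : 'M[C]_(m, n)) (B : 'M[C]_(n, p)) :
  (A *m B)^t* = B^t* *m A^t*.
Proof. by rewrite trmx_mul map_mxM. Qed.

Lemma adjmxB m n (A B : 'M[C]_(m, n)) : (A - B)^t* = A^t* - B^t*.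
Proof. by rewrite linearB /= map_mxB. Qed.

Lemma adjmx_tens m n p q (A : 'M[C]_(m, n)) (B : 'M[C]_(p, q)) :
  (A *t B)^t* = A^t* *t B^t*.
Proof. by rewrite trmx_tens map_mxT. Qed.

Lemma adjmx1 n : 1%:M^t* = 1%:M :> 'M[C]_n.
Proof. by rewrite trmx1 map_mx1. Qed.

Lemma ketbra_adj n (u v : 'cV[C]_n) : (ketbra u v)^t* = ketbra v u.
Proof. by rewrite /ketbra adjmxM trmxCK. Qed.

Lemma ketbraE n (u v : 'cV[C]_n) i j :
  ketbra u v i j = u i ord0 * (v j ord0)^*.
Proof. by rewrite mxE big_ord1 !mxE. Qed.

Lemma mxtrace_ketbra n (u v : 'cV[C]_n) : \tr (ketbra u v) = (v^t* *m u) ord0 ord0.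
Proof. by rewrite mxtrace_mulC trace_mx11. Qed.

Lemma mxtrace_tens m n (A : 'M[C]_m) (B : 'M[C]_n) :
  \tr (A *t B) = \tr A * \tr B.
Proof.
rewrite /mxtrace [LHS](reindex (@mxtens_index m n)) /=; last first.
  by exists (@mxtens_unindex m n) => ? _; rewrite ?mxtens_indexK ?mxtens_unindexK.
rewrite big_distrlr /= pair_big /=.
by apply: eq_bigr => -[i j] _; rewrite tensmxE.
Qed.

Lemma char_poly_conj n (P A : 'M[C]_n) : P \in unitmx ->
  char_poly (invmx P *m A *m P) = char_poly A.
Proof.
move=> Pu; rewrite /char_poly.
have -> : char_poly_mx (invmx P *m A *m P) =
    map_mx polyC (invmx P) *m char_poly_mx A *m map_mx polyC P.
  rewrite /char_poly_mx mulmxBr mulmxBl -!map_mxM; congr (_ - _).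
  by rewrite scalar_mxC -mulmxA -map_mxM mulVmx // map_mx1 mulmx1.
by rewrite !det_mulmx mulrAC -det_mulmx -map_mxM mulVmx // map_mx1 det1 mul1r.
Qed.

Lemma normalmx_spectral n (A : 'M[C]_n) : A \is normalmx ->
  A = (spectralmx A)^t* *m diag_mx (spectral_diag A) *m spectralmx A.
Proof.
by move=> /orthomx_spectralP {1}->; rewrite invmx_unitary // spectral_unitarymx.
Qed.

(** The rows of [spectralmx A] are the adjoints of orthonormal eigenvectors. Expressing eigenvalues
    through the quadratic form lets positivity of the form be read off the spectrum. *)
Lemma spectral_diagE n (A : 'M[C]_n) i : A \is normalmx ->
  let v := (row i (spectralmx A))^t* in
  spectral_diag A ord0 i = (v^t* *m A *m v) ord0 ord0.
Proof.
move=> /normalmx_spectral eA v; set P := spectralmx A.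
have PP : P *m P^t* = 1%:M by apply/unitarymxP/spectral_unitarymx.
transitivity ((P *m A *m P^t*) i i).
  by rewrite [X in _ *m X *m _]eA !mulmxA PP mul1mx -mulmxA PP mulmx1 mxE eqxx.
rewrite /v trmxCK -row_mul !mxE; apply: eq_bigr => j _.
by rewrite !mxE.
Qed.

(** This pins down [spectral_diag A] as a multiset, which is the way to compare spectra listed in
    unrelated orders. *)
Lemma prod_char_spectral n (A : 'M[C]_n) : A \is normalmx ->
  char_poly A = \prod_(i < n) ('X - (spectral_diag A ord0 i)%:P).
Proof.
move=> /orthomx_spectralP eA; rewrite {1}eA char_poly_conj ?spectral_unit //.
rewrite char_poly_trig ?diag_mx_is_trig //.
by apply: eq_bigr => i _; rewrite mxE eqxx.
Qed.

Lemma mxtrace_spectral n (A : 'M[C]_n) : A \is normalmx ->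
  \tr A = \sum_(i < n) spectral_diag A ord0 i.
Proof.
move=> /orthomx_spectralP {1}->.
by rewrite mxtrace_mulC mulKVmx ?spectral_unit // mxtrace_diag.
Qed.

Lemma adjmx_normal n (A : 'M[C]_n) : A^t* = A -> A \is normalmx.
Proof. by move=> hA; apply/normalmxP; rewrite hA. Qed.

Lemma spectral_diag_real n (A : 'M[C]_n) i : A^t* = A ->
  spectral_diag A ord0 i \is Num.real.
Proof.
move=> hA; have hs : A \is hermsymmx by rewrite qualifE /= expr0 scale1r hA.
by have /mxOverP := hermitian_spectral_diag_real hs; apply.
Qed.

(** [trace_norm] uses the eigenvalues of [A *m A], listed in an order unrelated to that of [A]. The
    eigenbasis of [A] diagonalises the square too, so both lists factor the same characteristic
    polynomial and agree up to permutation. For a real eigenvalue s, the root of s^2 is |s|. *)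
Lemma trace_normE n (A : 'M[C]_n) : A^t* = A ->
  trace_norm A = \sum_(i < n) `|spectral_diag A ord0 i|.
Proof.
move=> hA; rewrite /trace_norm hA.
have A2n : A *m A \is normalmx by apply: adjmx_normal; rewrite adjmxM hA.
have nA := adjmx_normal hA.
have := prod_char_spectral A2n.
have /orthomx_spectralP eA := nA; set P := spectralmx A in eA.
have Pu : P \in unitmx by exact: spectral_unit.
set s := spectral_diag A; set t := spectral_diag (A *m A).
(* The square written in the eigenbasis of [A]; its characteristic polynomial then splits over the
   squared eigenvalues. *)
have -> : A *m A = invmx P *m diag_mx (\row_i (s ord0 i ^+ 2)) *m P.
  rewrite {1 2}eA !mulmxA mulmxK // -[X in X *m P]mulmxA; congr (_ *m _ *m _).
  rewrite mulmx_diag; congr diag_mx; apply/rowP => i; by rewrite !mxE expr2.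
rewrite char_poly_conj // char_poly_trig ?diag_mx_is_trig // => e.
have /prod_XsubC_eq st : \prod_(x <- [seq s ord0 i ^+ 2 | i : 'I_n]) ('X - x%:P)
    = \prod_(x <- [seq t ord0 i | i : 'I_n]) ('X - x%:P).
  rewrite !big_image /= -e; apply: eq_bigr => i _.
  by rewrite !mxE eqxx.
transitivity (\sum_(x <- [seq t ord0 i | i : 'I_n]) sqrtC x).
  by rewrite big_image.
rewrite -(perm_big _ st) big_image /=; apply: eq_bigr => i _.
rewrite normC_def; congr sqrtC; rewrite expr2; congr (_ * _).
by apply/esym/CrealP; exact: spectral_diag_real.
Qed.

(** An isometry on the left cancels in the product (U A)^* (U A), the only thing that the trace norm
    sees. *)
Lemma trace_norm_isometry n (U A : 'M[C]_n) : U^t* *m U = 1%:M ->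
  trace_norm (U *m A) = trace_norm A.
Proof.
by move=> uU; rewrite /trace_norm adjmxM mulmxA -[_ *m U]mulmxA uU mulmx1.
Qed.

End Adjoint.

(** * Positive semidefinite operators *)

Section Positive.
Variable C : numClosedFieldType.

Lemma psdmx_conj m n (A : 'M[C]_n) (B : 'M[C]_(m, n)) :
  psdmx A -> psdmx (B *m A *m B^t*).
Proof.
move=> pA v; have := pA (B^t* *m v).
by rewrite adjmxM trmxCK !mulmxA.
Qed.

Lemma psdmxD n (A B : 'M[C]_n) : psdmx A -> psdmx B -> psdmx (A + B).
Proof.
by move=> pA pB v; rewrite mulmxDr mulmxDl mxE addr_ge0 ?pA ?pB.
Qed.

Lemma psdmxZ n (c : C) (A : 'M[C]_n) : 0 <= c -> psdmx A -> psdmx (c *: A).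
Proof.
by move=> c0 pA v; rewrite -scalemxAr -scalemxAl mxE mulr_ge0 ?pA.
Qed.

Lemma psdmx_sum n I (r : seq I) (F : I -> 'M[C]_n) :
  (forall i, psdmx (F i)) -> psdmx (\sum_(i <- r) F i).
Proof.
move=> pF; elim/big_ind: _ => // [v|]; last exact: psdmxD.
by rewrite mulmx0 mul0mx mxE.
Qed.

Lemma psdmx_gram m n (G : 'M[C]_(m, n)) : psdmx (G *m G^t*).
Proof.
move=> v; rewrite -!mulmxA mulmxA mxE sumr_ge0 // => i _.
rewrite -[v^t* *m G]trmxCK adjmxM trmxCK !mxE mulrC.
exact: mul_conjC_ge0.
Qed.

Lemma psdmx_ketbra n (u : 'cV[C]_n) : psdmx (ketbra u u).
Proof. exact: psdmx_gram. Qed.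

(* The skew-Hermitian part of a positive A is normal, and all its eigenvalues
   vanish because the quadratic form of A is real. *)
Lemma psdmx_adj n (A : 'M[C]_n) : psdmx A -> A^t* = A.
Proof.
move=> pA; apply/esym/eqP; rewrite -subr_eq0; set K := _ - _.
have hK : K^t* = - K by rewrite adjmxB trmxCK opprB.
have nK : K \is normalmx by apply/normalmxP; rewrite hK mulmxN mulNmx.
have K0 (v : 'cV[C]_n) : (v^t* *m K *m v) ord0 ord0 = 0.
  rewrite mulmxBr mulmxBl mxE [X in _ + X]mxE.
  suff -> : (v^t* *m A^t* *m v) = (v^t* *m A *m v)^t*.
    by rewrite 2![in X in _ - X]mxE conj_Creal ?subrr // ger0_real.
  by rewrite !adjmxM trmxCK mulmxA.
have /orthomx_spectralP -> := nK.
suff -> : spectral_diag K = 0 by rewrite linear0 mulmx0 mul0mx.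
by apply/rowP => i; rewrite spectral_diagE // K0 mxE.
Qed.

Lemma psdmx_spectralP n (A : 'M[C]_n) : A^t* = A ->
  (forall i, 0 <= spectral_diag A ord0 i) <-> psdmx A.
Proof.
move=> hA; have nA := adjmx_normal hA; split=> [s0|pA i]; last first.
  by rewrite spectral_diagE.
rewrite (normalmx_spectral nA) -[X in _ *m X]trmxCK; apply: psdmx_conj => v.
rewrite mul_mx_diag mxE sumr_ge0 // => i _; rewrite !mxE mulrAC.
by rewrite mulr_ge0 // mulrC mul_conjC_ge0.
Qed.

(** With A = P^* D P, take G = P^* sqrt(D). Such a factor gives positivity of tensor products and a
    decomposition of [A] into rank-one terms, the columns of G. *)
Lemma psdmx_factor n (A : 'M[C]_n) : psdmx A ->
  exists G : 'M[C]_n, A = G *m G^t*.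
Proof.
move=> pA; have hA := psdmx_adj pA; have nA := adjmx_normal hA.
have /(psdmx_spectralP hA) s0 := pA.
set D := diag_mx (\row_i sqrtC (spectral_diag A ord0 i)).
exists ((spectralmx A)^t* *m D); rewrite adjmxM trmxCK {1}(normalmx_spectral nA).
rewrite !mulmxA; congr (_ *m _); rewrite -!mulmxA; congr (_ *m _).
rewrite tr_diag_mx map_diag_mx mulmx_diag; congr diag_mx; apply/rowP => i.
by rewrite !mxE -normCK ger0_norm ?sqrtC_ge0 // sqrtCK.
Qed.

Lemma psdmx_tens m n (A : 'M[C]_m) (B : 'M[C]_n) :
  psdmx A -> psdmx B -> psdmx (A *t B).
Proof.
move=> /psdmx_factor[G ->] /psdmx_factor[H ->].
by rewrite -tensmx_mul -adjmx_tens; exact: psdmx_gram.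
Qed.

Lemma gram_sum_ketbra m n (G : 'M[C]_(m, n)) :
  G *m G^t* = \sum_k ketbra (col k G) (col k G).
Proof.
apply/matrixP => i j; rewrite summxE mxE.
by apply: eq_bigr => k _; rewrite ketbraE !mxE.
Qed.

Lemma trace_norm_psd n (A : 'M[C]_n) : psdmx A -> trace_norm A = \tr A.
Proof.
move=> pA; have hA := psdmx_adj pA; have /(psdmx_spectralP hA) s0 := pA.
rewrite trace_normE // mxtrace_spectral ?adjmx_normal //.
by apply: eq_bigr => i _; rewrite ger0_norm.
Qed.

(** Eigenvalue by eigenvalue, s <= |s|, and the inequality is strict at a negative one, which exists
    because [A] is not positive. *)
Lemma mxtrace_lt_trace_norm n (A : 'M[C]_n) : A^t* = A -> ~ psdmx A ->
  \tr A < trace_norm A.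
Proof.
move=> hA /(psdmx_spectralP hA)/existsNP[i /negP si].
rewrite trace_normE // mxtrace_spectral ?adjmx_normal //.
rewrite (bigD1 i) //= [ltRHS](bigD1 i) //= ltr_leD //.
  rewrite lt_def real_ler_norm ?spectral_diag_real // andbT.
  by apply: contra si => /eqP <-; exact: normr_ge0.
by apply: ler_sum => j _; rewrite real_ler_norm ?spectral_diag_real.
Qed.

End Positive.

(** * The maps id (x) L, entangled operators and Choi's criterion *)

Section TensorMaps.
Variable C : numClosedFieldType.

Lemma tensmxPr m n p q (A : 'M[C]_(m, n)) (c : C) (B D : 'M[C]_(p, q)) :
  A *t (c *: B + D) = c *: (A *t B) + A *t D.
Proof. by apply/matrixP => i j; rewrite !mxE mulrDr mulrCA. Qed.

Lemma tensmx_blocks m n (X : 'M[C]_(m * n)) :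
  X = \sum_(i < m) \sum_(j < m) delta_mx i j *t
    \matrix_(k, l) X (mxtens_index (i, k)) (mxtens_index (j, l)).
Proof.
apply/matrixP => p q.
case: (mxtens_indexP p) => i k; case: (mxtens_indexP q) => j l.
rewrite summxE (bigD1 i) //= summxE (bigD1 j) //= tensmxE !mxE !eqxx mul1r.
rewrite [X in _ + X + _]big1 ?addr0 => [|j' /negPf j'j]; last first.
  by rewrite tensmxE !mxE eqxx [j == _]eq_sym j'j mul0r.
rewrite big1 ?addr0 // => i' /negPf i'i.
rewrite summxE big1 // => j' _.
by rewrite tensmxE !mxE [i == _]eq_sym i'i mul0r.
Qed.

Lemma idtens_is_linear m n (L : 'End('M[C]_n)) : linear (@idtens C m n L).
Proof.
move=> c X Y; rewrite /idtens scaler_sumr -big_split; apply: eq_bigr => i _ /=.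
rewrite scaler_sumr -big_split; apply: eq_bigr => j _ /=.
rewrite -tensmxPr -linearP; congr (_ *t L _).
by apply/matrixP => k l; rewrite !mxE.
Qed.
HB.instance Definition _ m n (L : 'End('M[C]_n)) :=
  GRing.isLinear.Build C _ _ _ (@idtens C m n L) (idtens_is_linear L).

Lemma idtensB m n (L : 'End('M[C]_n)) (X Y : 'M[C]_(m * n)) :
  idtens L (X - Y) = idtens L X - idtens L Y.
Proof. exact: linearB. Qed.

Lemma idtens_comp m n (L K : 'End('M[C]_n)) (X : 'M[C]_(m * n)) :
  idtens (L \o K)%VF X = idtens L (idtens K X).
Proof.
rewrite [idtens K X]/idtens linear_sum; apply: eq_bigr => i _.
rewrite linear_sum; apply: eq_bigr => j _ /=.
by rewrite idtensE comp_lfunE.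
Qed.

Lemma idtens_id m n (X : 'M[C]_(m * n)) : idtens \1%VF X = X.
Proof.
rewrite [RHS]tensmx_blocks; apply: eq_bigr => i _.
by apply: eq_bigr => j _; rewrite id_lfunE.
Qed.

Lemma mxtrace_idtens m n (L : 'End('M[C]_n)) (X : 'M[C]_(m * n)) :
  trace_preserving L -> \tr (idtens L X) = \tr X.
Proof.
move=> tpL; rewrite [in RHS](tensmx_blocks X) /idtens !linear_sum.
apply: eq_bigr => i _; rewrite !linear_sum; apply: eq_bigr => j _ /=.
by rewrite !mxtrace_tens tpL.
Qed.

(** Operators on the first factor commute with a map acting on the second. The shapes are
    rectangular so that the first factor may change dimension, as in Choi's argument. *)
Lemma idtens_mul m n q (L : 'End('M[C]_n)) (X : 'M[C]_(m * n))
    (A : 'M[C]_(q, m)) (B : 'M[C]_(m, q)) :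
  (A *t 1%:M) *m idtens L X *m (B *t 1%:M) =
  idtens L ((A *t 1%:M) *m X *m (B *t 1%:M)).
Proof.
rewrite [idtens L X]/idtens [in RHS](tensmx_blocks X).
rewrite !mulmx_sumr !mulmx_suml linear_sum; apply: eq_bigr => i _.
rewrite !mulmx_sumr !mulmx_suml linear_sum; apply: eq_bigr => j _ /=.
by rewrite !tensmx_mul !mul1mx !mulmx1 idtensE.
Qed.

(** For b = b' this is |w><w| with w the sum of the b_i (x) a_i, an unnormalised phi^+ when both
    families are orthonormal. The two families are kept apart so that the form survives different
    multiplications on the left and on the right. *)
Definition entangled m n k (b b' : 'I_k -> 'cV[C]_m) (a : 'I_k -> 'cV[C]_n) :
    'M[C]_(m * n) :=
  \sum_(i < k) \sum_(j < k) ketbra (b i) (b' j) *t ketbra (a i) (a j).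

Lemma eq_entangled m n k (b c b' c' : 'I_k -> 'cV[C]_m) (a : 'I_k -> 'cV[C]_n) :
  b =1 c -> b' =1 c' -> entangled b b' a = entangled c c' a.
Proof.
move=> bc bc'; apply: eq_bigr => i _; apply: eq_bigr => j _.
by rewrite bc bc'.
Qed.

Lemma entangled_mul m n k q (b b' : 'I_k -> 'cV[C]_m) (a : 'I_k -> 'cV[C]_n)
    (S T : 'M[C]_(q, m)) :
  (S *t 1%:M) *m entangled b b' a *m (T^t* *t 1%:M) =
  entangled (fun i => S *m b i) (fun i => T *m b' i) a.
Proof.
rewrite mulmx_sumr mulmx_suml; apply: eq_bigr => i _.
rewrite mulmx_sumr mulmx_suml; apply: eq_bigr => j _.
by rewrite !tensmx_mul mul1mx mulmx1 /ketbra adjmxM !mulmxA.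
Qed.

(** The hypothesis says, in coordinates, that w is the sum of the b_i (x) a_i. *)
Lemma entangled_ketbra m n k (b : 'I_k -> 'cV[C]_m) (a : 'I_k -> 'cV[C]_n)
    (w : 'cV[C]_(m * n)) :
  (forall p q, w (mxtens_index (p, q)) ord0 =
     \sum_i b i p ord0 * a i q ord0) ->
  entangled b b a = ketbra w w.
Proof.
move=> wE; apply/matrixP => s t.
case: (mxtens_indexP s) => p q; case: (mxtens_indexP t) => p' q'.
rewrite ketbraE !wE rmorph_sum big_distrlr summxE /=.
apply: eq_bigr => i _; rewrite summxE; apply: eq_bigr => j _.
by rewrite tensmxE !ketbraE rmorphM mulrACA.
Qed.

Lemma psdmx_entangled m n k (b : 'I_k -> 'cV[C]_m) (a : 'I_k -> 'cV[C]_n) :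
  psdmx (entangled b b a).
Proof.
rewrite (@entangled_ketbra _ _ _ _ _ (\col_s \sum_i b i (mxtens_unindex s).1 ord0
  * a i (mxtens_unindex s).2 ord0)); first exact: psdmx_ketbra.
by move=> p q; rewrite mxE mxtens_indexK.
Qed.

Definition orthonormal_family m k (b : 'I_k -> 'cV[C]_m) : Prop :=
  forall i j, (b i)^t* *m b j = (i == j)%:R%:M.

Lemma mxtrace_entangled m n k (b : 'I_k -> 'cV[C]_m) (a : 'I_k -> 'cV[C]_n) :
  orthonormal_family b -> orthonormal_family a -> \tr (entangled b b a) = k%:R.
Proof.
move=> ob oa; rewrite linear_sum /=.
rewrite (eq_bigr (fun=> 1)) ?sumr_const ?card_ord // => i _.
rewrite linear_sum (bigD1 i) //= mxtrace_tens !mxtrace_ketbra ob oa.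
rewrite eqxx !mxE mulr1n mulr1 big1 ?addr0 // => j /negPf ji.
by rewrite mxtrace_tens !mxtrace_ketbra ob ji !mxE mul0rn mul0r.
Qed.

(** The matrix with columns a_i is square, so its left inverse A^* is also a right inverse. *)
Lemma orthonormal_complete n (a : 'I_n -> 'cV[C]_n) : orthonormal_family a ->
  \sum_i ketbra (a i) (a i) = 1%:M.
Proof.
move=> oa; pose A := \matrix_(i, j) a j i ord0.
have colA i : col i A = a i by apply/colP => j; rewrite !mxE.
have /mulmx1C <- : A^t* *m A = 1%:M.
  apply/matrixP => i j; have /matrixP/(_ ord0 ord0) := oa i j.
  rewrite !mxE eqxx mulr1n => <-.
  by apply: eq_bigr => l _; rewrite !mxE.
by rewrite gram_sum_ketbra; apply: eq_bigr => i _; rewrite colA.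
Qed.

(** Expand w along the basis a of the second factor: c_i is the partial contraction of w with a_i.
    The c_i need not be orthonormal. *)
Lemma ketbra_entangled m n (a : 'I_n -> 'cV[C]_n) (w : 'cV[C]_(m * n)) :
  orthonormal_family a -> exists c : 'I_n -> 'cV[C]_m, ketbra w w = entangled c c a.
Proof.
move=> /orthonormal_complete a1.
pose c i : 'cV[C]_m :=
  \col_p \sum_q w (mxtens_index (p, q)) ord0 * (a i q ord0)^*.
exists c; apply/esym/entangled_ketbra => p q.
transitivity (\sum_q' w (mxtens_index (p, q')) ord0 * (q == q')%:R).
  rewrite (bigD1 q) //= eqxx mulr1 big1 ?addr0 // => q' /negPf qq'.
  by rewrite eq_sym qq' mulr0.
(* The Kronecker delta is replaced by the entries of the completeness relation for a. *)
transitivity (\sum_q' \sum_i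
    w (mxtens_index (p, q')) ord0 * (a i q' ord0)^* * a i q ord0).
  apply: eq_bigr => q' _; have /matrixP/(_ q q') := a1.
  rewrite summxE [RHS]mxE => <-; rewrite mulr_sumr; apply: eq_bigr => i _.
  by rewrite ketbraE -mulrA [a i q _ * _]mulrC.
rewrite exchange_big; apply: eq_bigr => i _.
by rewrite mxE mulr_suml.
Qed.

(* Choi's theorem: every |w><w| on C^q (x) C^n is the image of the
   maximally entangled one under S (x) 1 for a suitable S. *)
Lemma choi_completely_positive m n (V : 'End('M[C]_n))
    (b : 'I_n -> 'cV[C]_m) (a : 'I_n -> 'cV[C]_n) :
  orthonormal_family b -> orthonormal_family a -> psdmx (idtens V (entangled b b a)) ->
  completely_positive V.
Proof.
move=> ob oa pV q X /psdmx_factor[G ->].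
rewrite gram_sum_ketbra linear_sum; apply: psdmx_sum => k.
have [c ->] := ketbra_entangled (col k G) oa.
pose T : 'M[C]_(q, m) := \sum_i c i *m (b i)^t*.
have Tb i : T *m b i = c i.
  rewrite mulmx_suml (bigD1 i) //= -mulmxA ob eqxx mulmx1 big1 ?addr0 // => j ji.
  by rewrite -mulmxA ob (negPf ji) raddf0 mulmx0.
have := psdmx_conj (T *t 1%:M) pV.
rewrite adjmx_tens adjmx1 idtens_mul entangled_mul.
by rewrite (eq_entangled _ Tb Tb).
Qed.

End TensorMaps.

Lemma tensmx11 (C : numClosedFieldType) m n :
  1%:M *t 1%:M = 1%:M :> 'M[C]_(m * n).
Proof.
apply/matrixP => s t; case: (mxtens_indexP s) => i j; case: (mxtens_indexP t) => k l.
rewrite tensmxE !mxE (can_eq (@mxtens_indexK _ _)) xpair_eqE.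
by case: (i == k); rewrite ?mul1r ?mul0r.
Qed.

(** * The strict trace norm gap for a map that is not completely positive *)

Section Gap.
Variable C : numClosedFieldType.
Variables (m n : nat) (b : 'I_n -> 'cV[C]_m) (a : 'I_n -> 'cV[C]_n).
Variables (e : 'cV[C]_m) (rho : 'M[C]_n) (c : C).
Hypotheses (n_gt0 : (0 < n)%N) (b_on : orthonormal_family b) (a_on : orthonormal_family a).
Hypotheses (e_unit : e^t* *m e = 1%:M) (e_orth : forall i, (b i)^t* *m e = 0).
Hypotheses (rho_state : states rho) (c_gt0 : 0 < c).

(** The weights are free so that one family holds the difference of the two states (t < 0), its
    positive counterpart (t > 0), and the compression away from e (t = 0). *)
Let witness (s t : C) : 'M[C]_(m * n) :=
  s *: entangled b b a + t *: (ketbra e e *t rho).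

(** It acts as x on the b_i and as x + z on e. The pairs (1, 0), (1, -2) and (1, -1) give the
    identity, the reflection across the complement of e, and the projector onto that complement. *)
Let eop (x z : C) : 'M[C]_m := x%:M + z *: ketbra e e.

Let eop_adj x z : (eop x z)^t* = eop x^* z^*.
Proof.
by rewrite linearD /= map_mxD tr_scalar_mx map_scalar_mx linearZ /= map_mxZ ketbra_adj.
Qed.

Let eop_b x z i : eop x z *m b i = x *: b i.
Proof.
rewrite mulmxDl mul_scalar_mx -scalemxAl -mulmxA.
suff -> : e^t* *m b i = 0 by rewrite mulmx0 scaler0 addr0.
by rewrite -[LHS]trmxCK adjmxM trmxCK e_orth trmx0 map_mx0.
Qed.

Let eop_e x z : eop x z *m e = (x + z) *: e.
Proof.
by rewrite mulmxDl mul_scalar_mx -scalemxAl -mulmxA e_unit mulmx1 scalerDl.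
Qed.

(** The b_i and e are eigenvectors of [eop], so only the weights change. Independent operators on
    the two sides allow a one-sided multiplication, the other side being [eop 1 0]. *)
Let eop_witness x z x' z' s t :
  (eop x z *t 1%:M) *m witness s t *m ((eop x' z')^t* *t 1%:M) =
  witness (x * x'^* * s) ((x + z) * (x' + z')^* * t).
Proof.
rewrite /witness mulmxDr mulmxDl -!scalemxAr -!scalemxAl entangled_mul.
rewrite !tensmx_mul mul1mx mulmx1 mulmxA -mulmxA -adjmxM !eop_e.
congr (_ + _); apply/matrixP => i j; last first.
  by rewrite !mxE !big_ord1 !mxE rmorphM; ring.
rewrite [LHS]mxE [RHS]mxE !summxE !mulr_sumr; apply: eq_bigr => k _.
rewrite !summxE !mulr_sumr; apply: eq_bigr => l _.
by rewrite !eop_b !mxE !big_ord1 !mxE rmorphM; ring.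
Qed.

Let witness_psd s t : 0 <= s -> 0 <= t -> psdmx (witness s t).
Proof.
move=> s0 t0; apply: psdmxD; apply: psdmxZ => //; first exact: psdmx_entangled.
by apply: psdmx_tens; [exact: psdmx_ketbra | case: rho_state].
Qed.

Let reflection : 'M[C]_(m * n) := eop 1 (- 2) *t 1%:M.

Let reflection_adj : reflection^t* = reflection.
Proof.
by rewrite adjmx_tens adjmx1 eop_adj rmorph1 rmorphN /= conjC_nat.
Qed.

Let reflection_unitary : reflection^t* *m reflection = 1%:M.
Proof.
have refl2 : eop 1 (- 2) *m eop 1 (- 2) = 1%:M.
  rewrite {2}/eop mulmxDr mulmx1 -scalemxAr /ketbra mulmxA eop_e -scalemxAl.
  by apply/matrixP => i j; rewrite !mxE; ring.
by rewrite reflection_adj tensmx_mul refl2 mulmx1 tensmx11.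
Qed.

Let eop10_tens : eop 1 0 *t 1%:M = 1%:M :> 'M[C]_(m * n).
Proof. by rewrite /eop scale0r addr0 tensmx11. Qed.

Let eop10_adj : (eop 1 0)^t* = eop 1 0.
Proof. by rewrite eop_adj rmorph0 rmorph1. Qed.

Let idtens_reflectl (V : 'End('M[C]_n)) s t :
  reflection *m idtens V (witness s t) = idtens V (witness s (- t)).
Proof.
rewrite -[LHS]mulmx1 -eop10_tens idtens_mul -eop10_adj eop_witness.
by congr (idtens V (witness _ _)); rewrite ?addr0 ?rmorph1; ring.
Qed.

Let idtens_reflectr (V : 'End('M[C]_n)) s t :
  idtens V (witness s t) *m reflection = idtens V (witness s (- t)).
Proof.
rewrite -[LHS]mul1mx mulmxA -eop10_tens -reflection_adj adjmx_tens adjmx1.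
rewrite idtens_mul eop_witness.
by congr (idtens V (witness _ _)); rewrite ?rmorphD ?rmorphN rmorph1 /= ?conjC_nat; ring.
Qed.

(** [V] lacks complete positivity, so self-adjointness of [idtens V W] is not automatic and enters
    as a hypothesis. *)
Lemma trace_norm_gap (V : 'End('M[C]_n)) (W : 'M[C]_(m * n)) :
  W = c *: (n%:R^-1 *: entangled b b a - ketbra e e *t rho) ->
  trace_preserving V -> (idtens V W)^t* = idtens V W ->
  ~ completely_positive V -> trace_norm W < trace_norm (idtens V W).
Proof.
have -> : c *: (n%:R^-1 *: entangled b b a - ketbra e e *t rho) =
    witness (c / n%:R) (- c) by rewrite /witness scalerBr scalerA scaleNr.
move=> -> tpV hV nV; have s_gt0 : 0 < c / n%:R by rewrite divr_gt0 // ltr0n.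
rewrite -(trace_norm_isometry (idtens V _) reflection_unitary) idtens_reflectl opprK.
(* The same sign flip without [V]: the reflection lemma is used for the identity map. *)
have -> : trace_norm (witness (c / n%:R) (- c)) = trace_norm (witness (c / n%:R) c).
  rewrite -(trace_norm_isometry _ reflection_unitary) -[X in _ *m X]idtens_id.
  by rewrite idtens_reflectl idtens_id opprK.
rewrite trace_norm_psd; last by apply: witness_psd; exact: ltW.
rewrite -(mxtrace_idtens _ tpV); apply: mxtrace_lt_trace_norm.
  (* The flipped operator is the reflection times a Hermitian operator. Its adjoint has the
     reflection on the right, which flips the same sign. *)
  rewrite -[c in witness _ c]opprK -idtens_reflectl adjmxM hV reflection_adj.
  by rewrite idtens_reflectr.
(* Were the flipped operator positive, projecting e away would leave a positive multiple of the Choi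
   operator of [V], making [V] completely positive. *)
move=> /(psdmx_conj (eop 1 (- 1) *t 1%:M)).
rewrite adjmx_tens adjmx1 idtens_mul eop_witness subrr !mul0r mul1r rmorph1 mul1r.
rewrite /witness scale0r addr0 linearZ /= => pV; apply: nV.
apply: choi_completely_positive b_on a_on _.
have s_inv : 0 <= (c / n%:R)^-1 by rewrite invr_ge0 ltW.
by have := psdmxZ s_inv pV; rewrite scalerA mulVf ?gt_eqF // scale1r.
Qed.

End Gap.

(** * States, preimages under id (x) Ls, and small p *)

Lemma states_convex (C : numClosedFieldType) n (s t : C) (A B : 'M[C]_n) :
  0 <= s -> 0 <= t -> s + t = 1 -> states A -> states B ->
  states (s *: A + t *: B).
Proof.
move=> s0 t0 st [pA trA] [pB trB]; split; first by apply: psdmxD; apply: psdmxZ.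
by rewrite linearD /= !linearZ /= trA trB !mulr1.
Qed.

Lemma phi_plus_state (C : numClosedFieldType) m n (b : n.-tuple 'cV[C]_m)
    (a : n.-tuple 'cV[C]_n) : (0 < n)%N ->
  orthonormal_family (tnth b) -> orthonormal_family (tnth a) ->
  states (phi_plus b a).
Proof.
move=> n_gt0 ob oa; rewrite /phi_plus -/(entangled (tnth b) (tnth b) (tnth a)).
split; first by apply: psdmxZ; [rewrite invr_ge0 ler0n | exact: psdmx_entangled].
by rewrite linearZ /= mxtrace_entangled // mulVf // pnatr_eq0 -lt0n.
Qed.

Lemma ketbra_tens_state (C : numClosedFieldType) m n (e : 'cV[C]_m)
    (rho : 'M[C]_n) : e^t* *m e = 1%:M -> states rho ->
  states (ketbra e e *t rho).
Proof.
move=> e1 [prho trrho]; split; first by apply: psdmx_tens; first exact: psdmx_ketbra.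
by rewrite mxtrace_tens mxtrace_ketbra e1 trrho mxE !mulr1.
Qed.

Lemma bij_lker0 (C : fieldType) (U : vectType C) (L : 'End(U)) :
  bijective L -> lker L == 0%VS.
Proof. by move=> /bij_inj L_inj; apply/lker0P. Qed.

(** Bijectivity makes the kernel of [L] trivial, so [L^-1] is a genuine inverse and recovers the
    state that [tau] came from. *)
Lemma state_image_inv (C : numClosedFieldType) m n (L : 'End('M[C]_n)) tau :
  bijective L -> state_image m L tau ->
  states (idtens L^-1%VF tau) /\ idtens L (idtens L^-1%VF tau) = tau.
Proof.
move=> /bij_lker0 kerL [om om_st <-].
by rewrite -(idtens_comp _ _ om) lker0_compVf // idtens_id.
Qed.

(** Applying [Ls] to the difference of the preimages gives W = rho' - rho'', and applying [Lt] gives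
    the image of W under V = Lt Ls^-1; this is the setting of [trace_norm_gap]. *)
Lemma trace_norm_increase (C : numClosedFieldType) m n (Ls Lt : 'End('M[C]_n))
    (b : 'I_n -> 'cV[C]_m) (a : 'I_n -> 'cV[C]_n) (e : 'cV[C]_m)
    (rho : 'M[C]_n) (t : C) (rho' rho'' : 'M[C]_(m * n)) :
  (0 < n)%N -> orthonormal_family b -> orthonormal_family a ->
  e^t* *m e = 1%:M -> (forall i, (b i)^t* *m e = 0) -> states rho -> 0 < t ->
  rho' - rho'' = t *: (n%:R^-1 *: entangled b b a - ketbra e e *t rho) ->
  bijective Ls -> trace_preserving Ls ->
  state_image m Ls rho' -> state_image m Ls rho'' ->
  cptp Lt -> ~ completely_positive (Lt \o Ls^-1)%VF ->
  trace_norm (idtens Ls (idtens Ls^-1%VF rho' - idtens Ls^-1%VF rho''))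
    < trace_norm (idtens Lt (idtens Ls^-1%VF rho' - idtens Ls^-1%VF rho'')).
Proof.
move=> n_gt0 ob oa e1 be rho_st t_gt0 rhoB Ls_bij Ls_tp im' im'' [Lt_cp Lt_tp] nV.
have [[psd' _] inv'] := state_image_inv Ls_bij im'.
have [[psd'' _] inv''] := state_image_inv Ls_bij im''.
rewrite [in X in X < _]idtensB inv' inv''.
have LtE : idtens Lt (idtens Ls^-1%VF rho' - idtens Ls^-1%VF rho'') =
    idtens (Lt \o Ls^-1)%VF (rho' - rho'').
  by rewrite idtens_comp !idtensB.
rewrite LtE; apply: (trace_norm_gap n_gt0 ob oa e1 be rho_st t_gt0 rhoB) => //.
  (* The inverse of [Ls] preserves the trace: write Y as Ls (Ls^-1 Y). *)
  move=> Y; rewrite comp_lfunE Lt_tp.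
  by rewrite -[in RHS](lker0_lfunVK (bij_lker0 Ls_bij) Y) Ls_tp.
(* A difference of two positive operators, the images of states under id (x) Lt, is Hermitian. *)
by rewrite -LtE idtensB adjmxB !psdmx_adj //; apply: Lt_cp.
Qed.

(** The point at parameter p differs from A by p (A - B), which is small in norm when p is. *)
Lemma open_near_segment (R : realType) n (U : set 'M[Cplx R]_n)
    (A B : 'M[Cplx R]_n) : open U -> U A ->
  exists2 p0 : R, 0 < p0 &
    forall p : R, 0 < p < p0 -> U ((1 - p)%:C *: A + p%:C *: B).
Proof.
move=> oU UA; have /nbhs_ballP[eps /= eps_gt0 Ueps] := open_nbhs_nbhs (conj oU UA).
(* The added 1 keeps the denominator positive when A = B. The radius [eps] is a positive element of
   [Cplx R], hence real, so the bound on p is the real part of q. *)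
pose q : Cplx R := eps / (1 + `|A - B|).
have N_gt0 : 0 < 1 + `|A - B| by rewrite ltr_pwDl.
have q_gt0 : 0 < q by rewrite divr_gt0.
have qE : (complex.Re q)%:C = q by apply: RRe_real; exact: gtr0_real.
exists (complex.Re q) => [|p /andP[p_gt0 pq]]; first by rewrite -ltcR qE.
apply: Ueps; rewrite mx_norm_ball /ball_ /=.
have -> : A - ((1 - p)%:C *: A + p%:C *: B) = p%:C *: (A - B).
  by rewrite rmorphB rmorph1 scalerBl scale1r opprD opprB addrA addrCA subrr
    addr0 scalerBr.
rewrite normrZ.
have p0 : 0 < p%:C :> Cplx R by rewrite (@ltcR R 0).
rewrite gtr0_norm //.
have {}pq : p%:C < q by rewrite -qE ltcR.
rewrite (@le_lt_trans _ _ (p%:C * (1 + `|A - B|))) //.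
  by rewrite ler_wpM2l ?ltW // ltrDr.
by rewrite -ltr_pdivlMr.
Qed.

Theorem mainTheorem3 (R : realType) (d : nat) (d_ge1 : (1 <= d)%N)
    (Ls : 'End('M[Cplx R]_d)) (Ls_cptp : cptp Ls) (Ls_bij : bijective Ls)
    (a : d.-tuple 'cV[Cplx R]_d) (a_basis : orthonormal_basis fullv a)
    (HA : {vspace 'cV[Cplx R]_(d.+1)}) (dim_HA : \dim HA = d)
    (b : d.-tuple 'cV[Cplx R]_(d.+1)) (b_basis : orthonormal_basis HA b)
    (e : 'cV[Cplx R]_(d.+1)) (e_unit : e^t* *m e = 1%:M)
    (e_orth : forall v, v \in HA -> v^t* *m e = 0)
    (rhoS : 'M[Cplx R]_d) (rhoS_state : states rhoS)
    (sigma : 'M[Cplx R]_(d.+1 * d))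
    (sigma_int : interior_in_states (state_image d.+1 Ls) sigma) :
  exists2 p0 : R, 0 < p0 & forall p : R, 0 < p < p0 ->
    let rho' : 'M[Cplx R]_(d.+1 * d) :=
      (1 - p)%:C *: sigma + p%:C *: phi_plus b a in
    let rho'' : 'M[Cplx R]_(d.+1 * d) :=
      (1 - p)%:C *: sigma + p%:C *: (ketbra e e *t rhoS) in
    let rho1 := idtens (Ls^-1)%VF rho' in
    let rho2 := idtens (Ls^-1)%VF rho'' in
    [/\ states rho' /\ states rho'',
        state_image d.+1 Ls rho' /\ state_image d.+1 Ls rho'',
        states rho1 /\ states rho2
      & forall Lt : 'End('M[Cplx R]_d), cptp Lt ->
          ~ completely_positive (Lt \o Ls^-1)%VF ->
          trace_norm (idtens Ls (rho1 - rho2))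
            < trace_norm (idtens Lt (rho1 - rho2))].
Proof.
have [oa ob] : orthonormal_family (tnth a) /\ orthonormal_family (tnth b).
  by case: a_basis b_basis => _ ? [].
have eb i : (tnth b i)^t* *m e = 0.
  by apply: e_orth; apply: (basis_mem b_basis.1); exact: mem_tnth.
have phi_st := phi_plus_state d_ge1 ob oa.
have erho_st := ketbra_tens_state e_unit rhoS_state.
case: sigma_int => X [Xs XI [U oU XU]].
(* [U] is open among all matrices, so membership in X needs both nearness to sigma and being a
   state; the latter will come from convexity. *)
have [Us sigma_st] : U sigma /\ states sigma by move: Xs; rewrite XU.
have [p1 p1_gt0 Up1] := open_near_segment (phi_plus b a) oU Us.
have [p2 p2_gt0 Up2] := open_near_segment (ketbra e e *t rhoS) oU Us.
(* The bound 1 keeps the weight 1 - p nonnegative; p1 and p2 keep the two segments inside [U]. *)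
exists (Num.min 1 (Num.min p1 p2)); first by rewrite !lt_min ltr01 p1_gt0 p2_gt0.
move=> p /andP[p_gt0]; rewrite !lt_min => /and3P[p_lt1 pp1 pp2] rho' rho'' rho1 rho2.
have t_gt0 : 0 < p%:C :> Cplx R by rewrite (@ltcR R 0).
have s_ge0 : 0 <= (1 - p)%:C :> Cplx R by rewrite (@lecR R 0) subr_ge0 ltW.
have st1 : (1 - p)%:C + p%:C = 1 :> Cplx R by rewrite -rmorphD subrK rmorph1.
have rho'_st : states rho' := states_convex s_ge0 (ltW t_gt0) st1 sigma_st phi_st.
have rho''_st : states rho'' :=
  states_convex s_ge0 (ltW t_gt0) st1 sigma_st erho_st.
have im' : state_image d.+1 Ls rho'.
  by apply: XI; rewrite XU; split; [apply: Up1; rewrite p_gt0 | exact: rho'_st].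
have im'' : state_image d.+1 Ls rho''.
  by apply: XI; rewrite XU; split; [apply: Up2; rewrite p_gt0 | exact: rho''_st].
have rhoB : rho' - rho'' = (p%:C : Cplx R) *: (d%:R^-1 *:
    entangled (tnth b) (tnth b) (tnth a) - ketbra e e *t rhoS).
  by rewrite /rho' /rho'' opprD addrACA subrr add0r -scalerBr.
split; [exact: conj | exact: conj | split | move=> Lt Lt_cptp nV].
- exact: (state_image_inv Ls_bij im').1.
- exact: (state_image_inv Ls_bij im'').1.
- exact: (trace_norm_increase d_ge1 ob oa e_unit eb rhoS_state t_gt0 rhoB
    Ls_bij Ls_cptp.2 im' im'' Lt_cptp nV).
Qed.
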